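(* Let $\ell$ be an odd prime with $\ell\mid q-\eta$. Let $m\ge1$, $\alpha,\gamma\ge0$ be integers such that the basic subgroup $\tilde R_{m,\alpha,\gamma}$ is a radical $\ell$-subgroup of $\tilde G_{m,\alpha,\gamma}=\mathrm{GL}_{m\ell^{\alpha+\gamma}}(\eta q)$. Then $\tilde R_{m,\alpha,\gamma}$ is special with respect to $G_{m,\alpha,\gamma}=\mathrm{SL}_{m\ell^{\alpha+\gamma}}(\eta q)$ if and only if $\gamma+\nu(m)\ge a$ or $\alpha=0$.
   Context: Let $p$ be a prime, $q$ a power of $p$, $\eta\in\{1,-1\}$, $\overline{\mathbb F}$ an algebraic closure of $\mathbb F_q$. On $\mathrm{GL}_N(\overline{\mathbb F})$ let $F$ be $A\mapsto A^{(q)}$ (entrywise $q$-th powers) if $\eta=1$, and $A\mapsto((A^{(q)})^{-1})^t$ if $\eta=-1$. $\mathrm{GL}_N((\eta q)^k)$ denotes the fixed points of $F^k$; so $\mathrm{GL}_N(\eta q)$ is $\mathrm{GL}_N(q)$ or $\mathrm{GU}_N(q)$, and $\mathrm{SL}_N(\eta q)$ is its subgroup of determinant 1. $\ell\neq p$ is an odd prime with $\ell\mid q-\eta$, $\nu$ is the $\ell$-adic valuation, $a=\nu(q-\eta)$. Tensor product of matrices: $A\otimes B=(b_{ij}A)$. Basic subgroups $\tilde R_{m,\alpha,\gamma}$: fix $\zeta\in\overline{\mathbb F}^\times$ of order $\ell^{a+\alpha}$, $\zeta_\ell=\zeta^{\ell^{a+\alpha-1}}$, $x=\mathrm{diag}(1,\zeta_\ell,\dots,\zeta_\ell^{\ell-1})$,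 $y=\begin{pmatrix}0&1\\ I_{\ell-1}&0\end{pmatrix}$; for $1\le j\le\gamma$, $x_j$, $y_j$ are the $\gamma$-fold tensor products with $x$, resp. $y$, in position $j$ and $I_\ell$ elsewhere. Let $R^0=\langle \zeta I_{m\ell^\gamma},\,I_m\otimes x_j,\,I_m\otimes y_j: 1\le j\le\gamma\rangle\le\mathrm{GL}_{m\ell^\gamma}((\eta q)^{\ell^\alpha})$. Put $k=\ell^\alpha$, choose $g_1\in\mathrm{SL}_k(\overline{\mathbb F})$ with $g_1^{-1}F(g_1)=\begin{pmatrix}0&1\\ I_{k-1}&0\end{pmatrix}$ (the matrix $(1)$ if $k=1$), $g=I_{m\ell^\gamma}\otimes g_1$, and $\tilde R_{m,\alpha,\gamma}=\{g\,\mathrm{diag}(A,F(A),\dots,F^{k-1}(A))\,g^{-1}:A\in R^0\}\le\mathrm{GL}_{m\ell^{\alpha+\gamma}}(\eta q)$. An $\ell$-subgroup $\tilde R$ of a finite group $\tilde H$ is radical if $\tilde R=\mathrm O_\ell(N_{\tilde H}(\tilde R))$. If $H\unlhd\tilde H$, a radical $\ell$-subgroup $\tilde R$ of $\tilde H$ is special with respect to $H$ if $\tilde R=\mathrm O_\ell(N_{\tilde H}(\tilde R\cap H))$. *)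

(* Defs.v *)
From HB Require Import structures.
From mathcomp Require Import all_boot all_order all_algebra all_fingroup.
From mathcomp Require Import all_solvable all_field.
From mathcomp Require Import mxtens.

Set Implicit Arguments.
Unset Strict Implicit.
Unset Printing Implicit Defensive.

Import GRing.Theory.
Local Open Scope ring_scope.

(* F_q is a finite field Fq with q = #|Fq|, and its algebraic closure is a    *)
(* closed field Fbar that is algebraic over Fq along iota : Fq -> Fbar.       *)

(* A^(q) *)
Definition entrywise_q (Fq : finFieldType) (Fbar : closedFieldType) N
    (A : 'M[Fbar]_N) : 'M[Fbar]_N :=
  map_mx (fun x => x ^+ #|Fq|) A.

Definition Frob (Fq : finFieldType) (Fbar : closedFieldType) (eta : int) N
    (A : 'M[Fbar]_N) : 'M[Fbar]_N :=
  if eta == 1 then entrywise_q Fq A else (invmx (entrywise_q Fq A))^T.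

Section Frobenius.

Variables (Fq : finFieldType) (Fbar : closedFieldType).
Variable iota : {rmorphism Fq -> Fbar}.
Implicit Types (eta : int) (N k : nat).

Let charq : [pchar Fbar].-nat #|Fq|.
Proof.
have [p p_pr charFq] := finPcharP Fq.
have charFb : p \in [pchar Fbar] by rewrite (fmorph_pchar iota).
rewrite (eq_pnat _ (pcharf_eq charFb)).
by have := pprimeChar_pgroup charFq; rewrite /pgroup cardsT.
Qed.

Let powq (x : Fbar) := x ^+ #|Fq|.

Let powq_nmod : nmod_morphism powq.
Proof.
split=> [|x y]; rewrite /powq; last exact: exprDn_pchar.
by rewrite expr0n -[_ == _]negbK -lt0n (ltn_trans _ (finNzRing_gt1 Fq)).
Qed.

Let powq_monoid : monoid_morphism powq.
Proof. by split=> [|x y]; rewrite /powq ?expr1n ?exprMn. Qed.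

HB.instance Definition _ := GRing.isNmodMorphism.Build Fbar Fbar powq powq_nmod.
HB.instance Definition _ :=
  GRing.isMonoidMorphism.Build Fbar Fbar powq powq_monoid.

Let entrywiseE N (A : 'M_N) : entrywise_q Fq A = map_mx powq A.
Proof. by []. Qed.

Local Notation entrywise_q := (entrywise_q Fq).
Local Notation Frob := (Frob Fq).

Lemma entrywise_q_unit N (A : 'M[Fbar]_N) :
  (entrywise_q A \in unitmx) = (A \in unitmx).
Proof. by rewrite entrywiseE map_unitmx. Qed.

Lemma entrywise_qM N (A B : 'M[Fbar]_N) :
  entrywise_q (A *m B) = entrywise_q A *m entrywise_q B.
Proof. by rewrite !entrywiseE map_mxM. Qed.

Lemma entrywise_q1 N : entrywise_q (1%:M : 'M[Fbar]_N) = 1%:M.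
Proof. by rewrite entrywiseE map_mx1. Qed.

Lemma entrywise_q_invmx N (A : 'M[Fbar]_N) :
  entrywise_q (invmx A) = invmx (entrywise_q A).
Proof. by rewrite !entrywiseE map_invmx. Qed.

Lemma entrywise_q_tr N (A : 'M[Fbar]_N) : entrywise_q A^T = (entrywise_q A)^T.
Proof. by apply/matrixP=> i j; rewrite !mxE. Qed.

Lemma invmxM N (A B : 'M[Fbar]_N) : A \in unitmx -> B \in unitmx ->
  invmx (A *m B) = invmx B *m invmx A.
Proof.
move=> uA uB; have uAB : A *m B \in unitmx by rewrite unitmx_mul uA.
by rewrite -[RHS](mulmxK uAB) mulmxA -(mulmxA _ _ A) mulVmx // mulmx1
  mulVmx // mul1mx.
Qed.

Lemma Frob_unit eta N (A : 'M[Fbar]_N) :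
  (Frob eta A \in unitmx) = (A \in unitmx).
Proof.
by rewrite /Frob; case: ifP; rewrite ?unitmx_tr ?unitmx_inv entrywise_q_unit.
Qed.

Lemma FrobM eta N (A B : 'M[Fbar]_N) : A \in unitmx -> B \in unitmx ->
  Frob eta (A *m B) = Frob eta A *m Frob eta B.
Proof.
move=> uA uB; rewrite /Frob entrywise_qM; case: ifP => // _.
by rewrite invmxM ?entrywise_q_unit // trmx_mul.
Qed.

Lemma Frob1 eta N : Frob eta (1%:M : 'M[Fbar]_N) = 1%:M.
Proof. by rewrite /Frob entrywise_q1 invmx1 trmx1 if_same. Qed.

Lemma Frob_invmx eta N (A : 'M[Fbar]_N) : A \in unitmx ->
  Frob eta (invmx A) = invmx (Frob eta A).
Proof.
move=> uA; have uFA : Frob eta A \in unitmx by rewrite Frob_unit.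
rewrite -[LHS](mulmxK uFA) -FrobM ?unitmx_inv // mulVmx //.
by rewrite Frob1 mul1mx.
Qed.

Lemma iter_Frob_unit eta N k (A : 'M[Fbar]_N) :
  (iter k (Frob eta (N := N)) A \in unitmx) = (A \in unitmx).
Proof. by elim: k => //= k IH; rewrite Frob_unit. Qed.

Lemma iter_FrobM eta N k (A B : 'M[Fbar]_N) : A \in unitmx -> B \in unitmx ->
  iter k (Frob eta (N := N)) (A *m B) =
  iter k (Frob eta (N := N)) A *m iter k (Frob eta (N := N)) B.
Proof. by move=> uA uB; elim: k => //= k ->; rewrite FrobM ?iter_Frob_unit. Qed.

Lemma iter_Frob1 eta N k : iter k (Frob eta (N := N)) (1%:M : 'M[Fbar]_N) = 1%:M.
Proof. by elim: k => //= k ->; rewrite Frob1. Qed.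

Lemma iter_Frob_invmx eta N k (A : 'M[Fbar]_N) : A \in unitmx ->
  iter k (Frob eta (N := N)) (invmx A) = invmx (iter k (Frob eta (N := N)) A).
Proof. by move=> uA; elim: k => //= k ->; rewrite Frob_invmx ?iter_Frob_unit. Qed.

Lemma Frob_Frob eta N (A : 'M[Fbar]_N) :
  A \in unitmx -> Frob eta (Frob eta A) = entrywise_q (entrywise_q A).
Proof.
move=> uA; rewrite /Frob; case: (eta == 1) => //.
by rewrite entrywise_q_tr entrywise_q_invmx -trmx_inv trmxK
  invmxK.
Qed.

Lemma Frob_fix_entry eta N k (A : 'M[Fbar]_N) i j :
    A \in unitmx -> iter k (Frob eta (N := N)) A = A ->
  A i j ^+ (#|Fq| ^ k.*2) = A i j.
Proof.
move=> uA fixA; have fix2A : iter k.*2 (Frob eta (N := N)) A = A.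
  by rewrite -addnn iterD !fixA.
suff /(_ k) E: forall r, iter r.*2 (Frob eta (N := N)) A i j
    = A i j ^+ (#|Fq| ^ r.*2) by rewrite -E fix2A.
elim=> // r IHr; rewrite doubleS !iterS Frob_Frob ?iter_Frob_unit // !mxE IHr.
by rewrite -!exprM mulnA -!expnSr.
Qed.

(* F^2 is A |-> A^(q^2) on GL_N, so the entries of a fixed point of F^k are   *)
(* among these roots; this is what makes GLfix below a finite type.           *)
Definition Fqk_roots k : seq Fbar :=
  sval (closed_field_poly_normal ('X^(#|Fq| ^ k.*2) - 'X : {poly Fbar})).

Lemma mem_Fqk_roots k x : (0 < k)%N -> x ^+ (#|Fq| ^ k.*2) = x ->
  x \in Fqk_roots k.
Proof.
move=> k_gt0 fixx; rewrite /Fqk_roots; case: closed_field_poly_normal => r /= Dr.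
have q_gt1 : (1 < #|Fq| ^ k.*2)%N.
  by rewrite -(exp1n k.*2) ltn_exp2r ?double_gt0 // finNzRing_gt1.
have nz : lead_coef ('X^(#|Fq| ^ k.*2) - 'X : {poly Fbar}) != 0.
  rewrite lead_coef_eq0 -size_poly_eq0 size_polyDl ?size_polyXn //.
  by rewrite size_polyN size_polyX ltnS.
have: root ('X^(#|Fq| ^ k.*2) - 'X) x by rewrite rootE !hornerE fixx subrr.
by rewrite Dr rootZ // root_prod_XsubC.
Qed.

End Frobenius.

(* GL_N((eta q)^k) *)
Record GLfix (Fq : finFieldType) (Fbar : closedFieldType)
    (iota : {rmorphism Fq -> Fbar}) (eta : int) (N k : nat) (k_gt0 : (0 < k)%N)
    : predArgType :=
  MkGLfix {
    glval :> 'M[Fbar]_N;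
    _ : (glval \in unitmx) && (iter k (@Frob Fq Fbar eta N) glval == glval)
  }.

Section GLfixGroup.

Variables (Fq : finFieldType) (Fbar : closedFieldType).
Variables (iota : {rmorphism Fq -> Fbar}) (eta : int) (N k : nat).
Variable k_gt0 : (0 < k)%N.
Local Notation GL := (GLfix iota eta N k_gt0).

HB.instance Definition _ := [isSub of GL for @glval _ _ iota eta N k k_gt0].
HB.instance Definition _ := [Choice of GL by <:].

Lemma glval_unit (A : GL) : glval A \in unitmx.
Proof. by case/andP: (valP A). Qed.

Lemma glval_fix (A : GL) : iter k (@Frob Fq Fbar eta N) (glval A) = glval A.
Proof. by case/andP: (valP A) => _ /eqP. Qed.

Local Notation K := (seq_sub (Fqk_roots Fq Fbar k)).

Let GL_to_fin (A : GL) : {ffun 'I_N * 'I_N -> option K} :=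
  [ffun ij => insub (glval A ij.1 ij.2)].

Let fin_to_GL (f : {ffun 'I_N * 'I_N -> option K}) : option GL :=
  insub (\matrix_(i, j) oapp val 0 (f (i, j))).

Let GL_to_finK : pcancel GL_to_fin fin_to_GL.
Proof.
move=> A; rewrite /fin_to_GL.
suff -> : \matrix_(i, j) oapp val 0 (GL_to_fin A (i, j)) = val A by rewrite valK.
apply/matrixP=> i j; rewrite mxE ffunE /= insubT //=.
apply: mem_Fqk_roots => //.
exact: Frob_fix_entry (glval_unit A) (glval_fix A).
Qed.

HB.instance Definition _ := Countable.copy GL (pcan_type GL_to_finK).
HB.instance Definition _ : isFinite GL := PCanIsFinite GL_to_finK.

Let one_proof : ((1%:M : 'M[Fbar]_N) \in unitmx) &&
  (iter k (@Frob Fq Fbar eta N) 1%:M == 1%:M).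
Proof. by rewrite unitmx1 iter_Frob1 ?eqxx. Qed.

Let mul_proof (A B : GL) : ((glval A *m glval B) \in unitmx) &&
  (iter k (@Frob Fq Fbar eta N) (glval A *m glval B) == glval A *m glval B).
Proof.
rewrite unitmx_mul !glval_unit iter_FrobM ?glval_unit //.
by rewrite !glval_fix eqxx.
Qed.

Let inv_proof (A : GL) : (invmx (glval A) \in unitmx) &&
  (iter k (@Frob Fq Fbar eta N) (invmx (glval A)) == invmx (glval A)).
Proof.
by rewrite unitmx_inv glval_unit iter_Frob_invmx ?glval_unit // glval_fix eqxx.
Qed.

Definition GLfix_one : GL := MkGLfix iota k_gt0 one_proof.
Definition GLfix_mul (A B : GL) : GL := MkGLfix iota k_gt0 (mul_proof A B).
Definition GLfix_inv (A : GL) : GL := MkGLfix iota k_gt0 (inv_proof A).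

Let mulA : associative GLfix_mul.
Proof. by move=> A B C; apply: val_inj; rewrite /= mulmxA. Qed.
Let mul1 : left_id GLfix_one GLfix_mul.
Proof. by move=> A; apply: val_inj; rewrite /= mul1mx. Qed.
Let mulV : left_inverse GLfix_one GLfix_inv GLfix_mul.
Proof. by move=> A; apply: val_inj; rewrite /= mulVmx ?glval_unit. Qed.

HB.instance Definition _ := Finite_isGroup.Build GL mulA mul1 mulV.

Definition SLfix : {set GL} := [set A : GL | \det (glval A) == 1].

Lemma SLfix_group_set : group_set SLfix.
Proof.
apply/group_setP; split=> [|A B]; rewrite !inE /= ?det1 //.
by rewrite det_mulmx => /eqP-> /eqP->; rewrite mulr1.
Qed.

Canonical SLfix_group := Group SLfix_group_set.

End GLfixGroup.

Arguments SLfix {Fq Fbar} iota eta N {k} k_gt0.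
Arguments SLfix_group {Fq Fbar} iota eta N {k} k_gt0.

(* GL_N(eta q) and SL_N(eta q) *)
Notation GL_eta iota eta N := (GLfix iota eta N (ltn0Sn 0)).
Notation SL_eta iota eta N := (SLfix iota eta N (ltn0Sn 0)).

Section Radical.

Variable gT : finGroupType.

Definition radical_subgroup (l : nat) (Ht R : {set gT}) : bool :=
  [&& R \subset Ht, (l.-group R)%g & R == 'O_l('N_Ht(R))%g].

(* For H normal in Ht. *)
Definition special_subgroup (l : nat) (Ht H R : {set gT}) : bool :=
  radical_subgroup l Ht R && (R == 'O_l('N_Ht(R :&: H))%g).

End Radical.

(* A (x) B = (b_ij A): the blocks are indexed by the second factor, whereas   *)
(* mxtens' A *t B is (a_ij B).                                                *)
Definition tens (R : pzRingType) n k (A : 'M[R]_n) (B : 'M[R]_k)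
  : 'M[R]_(k * n) := B *t A.

(* M_1 (x) ... (x) M_c, with the factors numbered from 0 *)
Fixpoint bigtens (R : pzRingType) l c (M : nat -> 'M[R]_l) : 'M[R]_(l ^ c) :=
  if c is c'.+1 then
    castmx (esym (expnS l c'), esym (expnS l c')) (tens (bigtens c' M) (M c'))
  else 1%:M.

(* diag(B_0, ..., B_(k-1)) *)
Definition blockdiag (R : pzRingType) n k (B : nat -> 'M[R]_n)
  : 'M[R]_(k * n) := \sum_(i < k) tens (B i) (delta_mx i i).

(* The matrix (0 1; I_(d-1) 0), which is (1) for d = 1. *)
Definition cycle_mx (R : pzRingType) d : 'M[R]_d :=
  \matrix_(i, j) (i == j.+1 %% d :> nat)%N%:R.

Lemma prime_exp_gt0 l c : prime l -> (0 < l ^ c)%N.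
Proof. by move=> l_pr; rewrite expn_gt0 prime_gt0. Qed.

Section Basic.

Variables (Fq : finFieldType) (Fbar : closedFieldType).
Variables (iota : {rmorphism Fq -> Fbar}) (eta : int).
Variables (l m alpha gamma : nat).

Definition nu_qeta : nat := logn l (absz (#|Fq|%:Z - eta)).

Section R0.

Variables (l_pr : prime l) (zeta : Fbar).
Local Notation k_gt0 := (prime_exp_gt0 alpha l_pr).

(* diag(1, zeta_l, ..., zeta_l^(l-1)) *)
Definition basic_x : 'M[Fbar]_l :=
  let zeta_l := zeta ^+ (l ^ (nu_qeta + alpha - 1)) in
  diag_mx (\row_(i < l) zeta_l ^+ i).

Definition at_pos (j : nat) (M : 'M[Fbar]_l) : 'M[Fbar]_(l ^ gamma) :=
  bigtens gamma (fun i => if i == j then M else 1%:M).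

(* For zeta of order l^(a + alpha) the generators are fixed by F^(l^alpha),   *)
(* so each of them does occur in the set below.                               *)
Definition basic_R0 : {set GLfix iota eta (l ^ gamma * m) k_gt0} :=
  <<[set A : GLfix iota eta (l ^ gamma * m) k_gt0 |
      [|| glval A == zeta%:M,
          [exists j : 'I_gamma,
             glval A == tens (1%:M : 'M_m) (at_pos j basic_x)]
        | [exists j : 'I_gamma,
             glval A == tens (1%:M : 'M_m) (at_pos j (cycle_mx Fbar l))]]]>>%g.

End R0.

Lemma basic_dim : (l ^ alpha * (l ^ gamma * m) = m * l ^ (alpha + gamma))%N.
Proof. by rewrite mulnA -expnD mulnC. Qed.

(* g diag(A, F(A), ..., F^(k-1)(A)) g^-1 with k = l^alpha and g = I (x) g1    *)
Definition basic_conj (g1 : 'M[Fbar]_(l ^ alpha)) (A : 'M[Fbar]_(l ^ gamma * m))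
  : 'M[Fbar]_(m * l ^ (alpha + gamma)) :=
  let g := tens (1%:M : 'M_(l ^ gamma * m)) g1 in
  castmx (basic_dim, basic_dim)
    (g *m blockdiag (l ^ alpha) (fun i => iter i (@Frob Fq Fbar eta _) A)
       *m invmx g).

Definition basic_subgroup (l_pr : prime l) (zeta : Fbar)
    (g1 : 'M[Fbar]_(l ^ alpha))
    : {set GL_eta iota eta (m * l ^ (alpha + gamma))} :=
  [set X | [exists A in basic_R0 l_pr zeta, glval X == basic_conj g1 (glval A)]].

End Basic.

Arguments basic_subgroup {Fq Fbar} iota eta {l} m alpha gamma l_pr zeta g1.

(* Main.v *)
Require Import Defs.
From mathcomp Require Import all_boot all_order all_algebra all_fingroup.
From mathcomp Require Import all_solvable all_field.
From mathcomp Require Import mxtens ring.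

Set Implicit Arguments.
Unset Strict Implicit.
Unset Printing Implicit Defensive.

Import GRing.Theory.
Local Open Scope ring_scope.

(** Write k = l^alpha, n = m l^gamma and a = nu(q - eta).  In the coordinates
    given by g, an element of the basic subgroup R is a Kronecker product
    diag(c, c^Q, ..., c^(Q^(k-1))) (x) e, with blocks c^(Q^s) e, where c is a power of zeta, e lies in
    R^0, is fixed by F and has determinant 1, and x |-> x^Q is the action of F
    on scalars of order dividing l^(a + alpha); so Q stands for eta q
    ([basic_R0_decomposition], [basic_subgroupP]).  The natural number Q is
    chosen with nu(Q - 1) = a ([exists_twisted_exponent]); since l is odd,
    nu(Q^(l^j) - 1) = a + j ([logn_expn_pred]).

    For c = zeta^i the determinant of this product is zeta to the power
    i (1 + Q + ... + Q^(k-1)) n, and the sum has valuation alpha; hence the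
    determinant is 1 iff i = 0 or nu(i) + gamma + nu(m) >= a
    ([det_embedding]).  Let G be the special linear group.

    If gamma + nu(m) >= a then R lies in G, and specialness is radicality.  If
    alpha = 0 then R is generated by R :&: G and scalar matrices, so that R and
    R :&: G have the same normaliser ([special_alpha0]).

    Suppose that alpha > 0 and gamma + nu(m) < a ([not_special]).  Then only
    the c = zeta^i with l %| i occur in R :&: G, and for these the sequence
    c^(Q^s) has period k1 = l^(alpha-1), whereas for c = zeta it has not.
    Let M be the pseudo-reflection 1 + (w - 1) P of order l, where w has order
    l and P is the projection averaging over the residue classes mod k1.  Then
    h = M (x) 1 commutes with R :&: G.  It is also rational, for M commutes with
    the cyclic matrix that twists F, and F(M) = M because w^Q = w and P is
    symmetric: this works for the linear and for the unitary group alike.  If R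
    were equal to O_l(N(R :&: G)), it would be normalised by h; but conjugation
    by M does not even send diag(zeta, zeta^Q, ...) to a diagonal matrix, as
    l >= 3 makes M have two nonzero entries off the diagonal in one column. *)

(** * Valuations of geometric sums *)

Lemma exp_mod_square l u i :
  exists t, ((u * l).+1 ^ i = 1 + i * (u * l) + t * l ^ 2)%N.
Proof.
elim: i => [|i [t IHi]]; first by exists 0%N; rewrite expn0.
exists (i * u ^ 2 + t * (u * l).+1)%N; rewrite expnSr IHi -addn1 -[i.+1]addn1.
by ring.
Qed.

Lemma geometric_mod_square l u n :
  exists t,
    (\sum_(i < n) (u * l).+1 ^ i = n + 'C(n, 2) * (u * l) + t * l ^ 2)%N.
Proof.
elim: n => [|n [t IHn]]; first by exists 0%N; rewrite big_ord0.
have [s Ds] := exp_mod_square l u n; exists (t + s)%N.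
by rewrite big_ord_recr /= IHn Ds binS bin1 -[n.+1]addn1; ring.
Qed.

Lemma geometric_gt0 Q n : (0 < n)%N -> (0 < \sum_(i < n) Q ^ i)%N.
Proof. by case: n => // n _; rewrite big_ord_recl. Qed.

(** Modulo l^2 the sum is l + 'C(l, 2) (Q - 1), and l divides 'C(l, 2)
    because l is odd. *)
Lemma logn_geometric_prime l Q :
  prime l -> odd l -> (l %| Q.-1)%N -> (0 < Q)%N ->
  logn l (\sum_(i < l) Q ^ i) = 1%N.
Proof.
move=> l_pr l_odd /dvdnP[u Du] Q_gt0; have l_gt0 := prime_gt0 l_pr.
have l_gt2 : (2 < l)%N by rewrite odd_prime_gt2.
have -> : Q = (u * l).+1 by rewrite -Du prednK.
have [t ->] := geometric_mod_square l u l.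
have /dvdnP[c ->] : (l %| 'C(l, 2))%N by apply: prime_dvd_bin.
have -> : (l + c * l * (u * l) + t * l ^ 2 = l * ((c * u + t) * l + 1))%N.
  by ring.
rewrite lognM ?addn1 // logn_prime // eqxx logn_coprime ?addn0 //.
by rewrite prime_coprime // -addn1 dvdn_addr ?dvdn_mull // Euclid_dvd1.
Qed.

(** The sum of length l^(j+1) is the one of length l^j times a sum of length l
    in Q^(l^j). *)
Lemma logn_geometric l Q j :
  prime l -> odd l -> (l %| Q.-1)%N -> (0 < Q.-1)%N ->
  logn l (\sum_(i < l ^ j) Q ^ i) = j.
Proof.
move=> l_pr l_odd dvdQ Q1_gt0; have l_gt0 := prime_gt0 l_pr.
have Q_gt1 : (1 < Q)%N by case: (Q) Q1_gt0 => [|[]].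
elim: j => [|j IHj]; first by rewrite expn0 big_ord1 expn0 logn1.
pose R := (Q ^ (l ^ j))%N.
have R_gt1 : (1 < R)%N by rewrite -(expn0 Q) ltn_exp2l // expn_gt0 l_gt0.
have R_gt0 := ltnW R_gt1.
have R1_gt0 : (0 < R.-1)%N by rewrite -subn1 subn_gt0.
have dvdR : (l %| R.-1)%N by rewrite predn_exp dvdn_mulr.
have E : (\sum_(i < l ^ j.+1) Q ^ i =
          (\sum_(i < l ^ j) Q ^ i) * \sum_(i < l) R ^ i)%N.
  apply/eqP; rewrite -(eqn_pmul2l Q1_gt0) mulnA -!predn_exp -/R.
  by rewrite -expnM -expnSr.
rewrite E lognM ?geometric_gt0 ?expn_gt0 ?l_gt0 // IHj.
by rewrite logn_geometric_prime ?addn1.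
Qed.

(** Oddness of l is essential: for l = 2 and Q = 3 the valuation of Q^2 - 1
    is 3 instead of 2. *)
Lemma logn_expn_pred l Q j :
  prime l -> odd l -> (l %| Q.-1)%N -> (0 < Q.-1)%N ->
  logn l (Q ^ (l ^ j)).-1 = (logn l Q.-1 + j)%N.
Proof.
move=> l_pr l_odd dvdQ Q1_gt0; rewrite predn_exp lognM ?logn_geometric //.
by rewrite geometric_gt0 // expn_gt0 prime_gt0.
Qed.

(** * Kronecker products and cyclic matrices *)

Section Matrices.
Variable R : comPzRingType.

Lemma tensmx11 m n : (1%:M : 'M[R]_m) *t (1%:M : 'M[R]_n) = 1%:M.
Proof.
apply/matrixP=> i j.
case: (mxtens_indexP i) => i0 i1; case: (mxtens_indexP j) => j0 j1.
have inj_idx := can_inj (@mxtens_indexK m n).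
by rewrite tensmxE !mxE -natrM mulnb (inj_eq inj_idx) xpair_eqE.
Qed.

(** The two sizes may differ syntactically, as m * n and n * m do below. *)
Lemma det_mxsub_bij n n' (f : 'I_n' -> 'I_n) (A : 'M[R]_n) :
  n' = n -> injective f -> \det (mxsub f f A) = \det A.
Proof.
move=> En; case: n / En in f A * => f_inj.
have -> : mxsub f f A = row_perm (perm f_inj) (col_perm (perm f_inj) A).
  by apply/matrixP=> i j; rewrite !mxE !permE.
rewrite row_permE col_permE !det_mulmx !det_perm odd_permV mulrCA.
by rewrite -expr2 sqrr_sign mulr1.
Qed.

Lemma det_castmx n n' (e : n = n') (A : 'M[R]_n) :
  \det (castmx (e, e) A) = \det A.
Proof. by case: n' / e. Qed.

Lemma det_tens1mx m n (A : 'M[R]_n) : \det ((1%:M : 'M_m) *t A) = \det A ^+ m.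
Proof.
elim: m => [|m IHm]; first by rewrite det_mx00.
rewrite [1%:M](@scalar_mx_block _ 1 m) tens_block_mx det_castmx.
rewrite !tens0mx det_ublock IHm exprS; congr (_ * _).
by rewrite tens_scalar1mx det_castmx.
Qed.

(** A (x) B = (A (x) 1) (1 (x) B); the second factor is block diagonal, and
    exchanging the two indices makes the first one so. *)
Lemma det_tensmx m n (A : 'M[R]_m) (B : 'M[R]_n) :
  \det (A *t B) = \det A ^+ n * \det B ^+ m.
Proof.
rewrite tensmx_decr det_mulmx det_tens1mx; congr (_ * _).
pose f (i : 'I_(m * n)) : 'I_(n * m) :=
  mxtens_index ((mxtens_unindex i).2, (mxtens_unindex i).1).
have f_inj : injective f.
  move=> i j /(can_inj (@mxtens_indexK _ _))[] E2 E1.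
  apply: (can_inj (@mxtens_unindexK m n)); congr pair; exact: val_inj.
rewrite -(det_tens1mx n A) -(det_mxsub_bij _ _ f_inj) ?(mulnC m) //.
congr (\det _); apply/matrixP=> i j.
by rewrite !mxE !mxtens_indexK /= mulrC.
Qed.

End Matrices.

Lemma odd_permX (T : finType) (s : {perm T}) n :
  odd_perm (s ^+ n)%g = odd n && odd_perm s.
Proof.
elim: n => [|n IHn]; first by rewrite expg0 odd_perm1.
by rewrite expgS odd_permM IHn /=; case: (odd n); case: (odd_perm s).
Qed.

Definition shift_perm d : 'S_d := perm (@ordS_inj d).

Lemma shift_permX d n (i : 'I_d) :
  ((shift_perm d ^+ n)%g i = (i + n) %% d :> nat)%N.
Proof.
elim: n => [|n IHn]; first by rewrite expg0 perm1 addn0 modn_small.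
by rewrite expgSr permM permE /= IHn -[(_ %% d).+1]addn1 modnDml addn1 addnS.
Qed.

Section Cycle.
Variable R : comPzRingType.

Lemma cycle_mxE d : cycle_mx R d = (perm_mx (shift_perm d))^T.
Proof.
by apply/matrixP=> i j; rewrite !mxE permE -val_eqE /= eq_sym.
Qed.

Lemma cycle_mx_orthogonal d : cycle_mx R d *m (cycle_mx R d)^T = 1%:M.
Proof. by rewrite cycle_mxE trmxK tr_perm_mx -perm_mxM mulVg perm_mx1. Qed.

Lemma det_cycle_mx d : odd d -> \det (cycle_mx R d) = 1.
Proof.
move=> d_odd; rewrite cycle_mxE det_tr det_perm.
suff -> : odd_perm (shift_perm d) = false by [].
have <- : odd_perm (shift_perm d ^+ d)%g = odd_perm (shift_perm d).
  by rewrite odd_permX d_odd.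
suff -> : (shift_perm d ^+ d = 1)%g by rewrite odd_perm1.
apply/permP=> i; apply: val_inj.
by rewrite /= shift_permX perm1 modnDr modn_small.
Qed.

End Cycle.

(** * The Frobenius map *)

Section FrobeniusMap.
Variables (Fq : finFieldType) (Fbar : closedFieldType).
Variable iota : {rmorphism Fq -> Fbar}.
Variable eta : int.
Local Notation q := #|Fq|.
Local Notation Frob := (@Frob Fq Fbar eta _).

Lemma q_gt0 : (0 < q)%N. Proof. exact: ltnW (finNzRing_gt1 Fq). Qed.

(** Fbar has the characteristic of Fq, so #|Fq| is a power of it. *)
Lemma pchar_pnat_q : [pchar Fbar].-nat q.
Proof.
have [p _ charFq] := finPcharP Fq.
have charFb : p \in [pchar Fbar] by rewrite (fmorph_pchar iota).
rewrite (eq_pnat _ (pcharf_eq charFb)).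
by have := pprimeChar_pgroup charFq; rewrite /pgroup cardsT.
Qed.

Lemma expqD (x y : Fbar) : (x + y) ^+ q = x ^+ q + y ^+ q.
Proof. exact: exprDn_pchar pchar_pnat_q. Qed.

Lemma expq_nat n : (n%:R : Fbar) ^+ q = n%:R.
Proof.
elim: n => [|n IHn]; first by rewrite expr0n gtn_eqF ?q_gt0.
by rewrite -natr1 expqD IHn expr1n.
Qed.

Lemma expqN (x : Fbar) : (- x) ^+ q = - x ^+ q.
Proof.
apply/eqP; rewrite -addr_eq0 -expqD addNr expr0n gtn_eqF //.
exact: q_gt0.
Qed.

(** An orthogonal matrix equals its inverse transpose, so that it makes no
    difference whether eta is 1 or -1. *)
Lemma Frob_orthogonal n (A : 'M[Fbar]_n) :
  entrywise_q Fq A = A -> A *m A^T = 1%:M -> Frob A = A.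
Proof.
move=> fixA orthA; rewrite /Defs.Frob fixA; case: ifP => // _.
have uA : A \in unitmx by case/mulmx1_unit: orthA.
have -> : invmx A = A^T by rewrite -[RHS](mulKmx uA) orthA mulmx1.
by rewrite trmxK.
Qed.

Lemma Frob_cycle_mx d : Frob (cycle_mx Fbar d) = cycle_mx Fbar d.
Proof.
apply: Frob_orthogonal (cycle_mx_orthogonal _ _).
by apply/matrixP=> i j; rewrite !mxE expq_nat.
Qed.

Lemma Frob_castmx n n' (e : n = n') (A : 'M[Fbar]_n) :
  Frob (castmx (e, e) A) = castmx (e, e) (Frob A).
Proof. by case: n' / e. Qed.

Lemma entrywise_q_tens m n (A : 'M[Fbar]_m) (B : 'M[Fbar]_n) :
  entrywise_q Fq (A *t B) = entrywise_q Fq A *t entrywise_q Fq B.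
Proof. by apply/matrixP=> i j; rewrite !mxE exprMn. Qed.

Lemma tensmx_unitmx m n (A : 'M[Fbar]_m) (B : 'M[Fbar]_n) :
  A \in unitmx -> B \in unitmx -> A *t B \in unitmx.
Proof.
by rewrite !unitmxE det_tensmx unitrM => uA uB; rewrite !unitrX.
Qed.

Lemma invmx_tens m n (A : 'M[Fbar]_m) (B : 'M[Fbar]_n) :
  A \in unitmx -> B \in unitmx -> invmx (A *t B) = invmx A *t invmx B.
Proof.
move=> uA uB; have uAB := tensmx_unitmx uA uB.
by rewrite -[RHS](mulKmx uAB) tensmx_mul !mulmxV // tensmx11 mulmx1.
Qed.

Lemma Frob_tens m n (A : 'M[Fbar]_m) (B : 'M[Fbar]_n) :
  A \in unitmx -> B \in unitmx -> Frob (A *t B) = Frob A *t Frob B.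
Proof.
move=> uA uB; rewrite /Defs.Frob entrywise_q_tens; case: ifP => // _.
by rewrite invmx_tens ?(entrywise_q_unit iota) // trmx_tens.
Qed.

Lemma det1_unitmx n (A : 'M[Fbar]_n) : \det A = 1 -> A \in unitmx.
Proof. by rewrite unitmxE => ->; rewrite unitr1. Qed.

Lemma bigtens_Frob_det1 l c (M : nat -> 'M[Fbar]_l) :
  (forall i, Frob (M i) = M i /\ \det (M i) = 1) ->
  Frob (bigtens c M) = bigtens c M /\ \det (bigtens c M) = 1.
Proof.
move=> goodM; elim: c => [|c [IHF IHd]] /=.
  by rewrite (Frob1 iota) det1.
have [FM dM] := goodM c.
rewrite Frob_castmx Frob_tens ?det1_unitmx // FM IHF.
by split=> //; rewrite det_castmx det_tensmx dM IHd !expr1n mulr1.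
Qed.

Definition twisted_expq (x : Fbar) := if eta == 1 then x ^+ q else (x ^+ q)^-1.

Lemma Frob_diag_mx n (d : 'rV[Fbar]_n) : (forall i, d 0 i != 0) ->
  Frob (diag_mx d) = diag_mx (map_mx twisted_expq d).
Proof.
move=> nz_d; rewrite /Defs.Frob /twisted_expq.
have -> : entrywise_q Fq (diag_mx d) = diag_mx (map_mx (fun x => x ^+ q) d).
  apply/matrixP=> i j; rewrite !mxE; case: eqP => // _.
  by rewrite expr0n gtn_eqF ?q_gt0.
case: ifP => // _; set D := diag_mx _.
pose E : 'M_n := diag_mx (map_mx (fun x => (x ^+ q)^-1) d).
have DE : D *m E = 1%:M.
  rewrite mulmx_diag -diag_const_mx; congr diag_mx; apply/rowP=> i.
  by rewrite !mxE mulfV // expf_neq0.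
have [uD _] := mulmx1_unit DE.
by rewrite -[invmx D]mulmx1 -DE mulKmx // tr_diag_mx.
Qed.

(** For eta = -1 the integer -q is replaced by the natural number
    (l^b - 1) q with b = a + alpha + 1.  It is congruent to -q modulo l^b, hence
    modulo the order of x; and b > a ensures that Q - 1 = l^b q - (q + 1) keeps
    the valuation of q + 1. *)
Lemma exists_twisted_exponent (l alpha a : nat) :
  prime l -> (eta = 1 \/ eta = -1) ->
  logn l (absz (q%:Z - eta)) = a -> (0 < a)%N ->
  exists Q, [/\ (0 < Q.-1)%N, logn l Q.-1 = a &
    forall x : Fbar, x ^+ (l ^ (a + alpha)) = 1 -> twisted_expq x = x ^+ Q].
Proof.
move=> l_pr eta_def Da a_gt0; have l_gt0 := prime_gt0 l_pr.
case: eta_def => Deta; rewrite /twisted_expq Deta /=.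
  exists q; split=> //; first by rewrite -subn1 subn_gt0 finNzRing_gt1.
  by rewrite -Da Deta -[1]/(1%N%:Z) subzn ?q_gt0 // subn1.
have {}Da : logn l q.+1 = a.
  by rewrite -Da Deta opprK -[1]/(1%N%:Z) -PoszD addn1.
pose b := (a + alpha).+1; exists ((l ^ b).-1 * q)%N.
have lb_gt1 : (1 < l ^ b)%N.
  by rewrite -{1}(expn0 l) ltn_exp2l // prime_gt1.
have Qq : ((l ^ b).-1 * q + q = l ^ b * q)%N.
  by rewrite -mulSnr prednK // ltnW.
have Q_gt1 : (1 < (l ^ b).-1 * q)%N.
  apply: leq_trans (finNzRing_gt1 Fq) _.
  by rewrite leq_pmull // -subn1 subn_gt0.
have E : (((l ^ b).-1 * q).-1 + q.+1 = l ^ b * q)%N.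
  by rewrite addnS -addSn prednK ?Qq // ltnW.
have Q1_gt0 : (0 < ((l ^ b).-1 * q).-1)%N by rewrite -subn1 subn_gt0.
split=> //.
  apply/eqP; rewrite eqn_leq; apply/andP; split.
    rewrite -ltnS ltnNge -pfactor_dvdn //; apply/negP=> dvdQ.
    have: (l ^ a.+1 %| q.+1)%N.
      rewrite -(dvdn_addr _ dvdQ) E dvdn_mulr // dvdn_exp2l //.
      by rewrite ltnS leq_addr.
    by rewrite pfactor_dvdn // Da ltnn.
  rewrite -pfactor_dvdn // -(dvdn_addl (n := q.+1)) ?E; last first.
    by rewrite pfactor_dvdn // Da.
  by rewrite dvdn_mulr // dvdn_exp2l // (leq_trans (leq_addr alpha a)).
move=> x xL1; have xb1 : x ^+ (l ^ b) = 1 by rewrite expnSr exprM xL1 expr1n.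
have nz_x : x != 0.
  apply: contra_eq_neq xb1 => ->.
  by rewrite expr0n gtn_eqF ?expn_gt0 ?l_gt0 // eq_sym oner_neq0.
have nz_xq : x ^+ q != 0 by rewrite expf_neq0.
by apply: (mulIf nz_xq); rewrite mulVf // -exprD Qq exprM xb1 expr1n.
Qed.

End FrobeniusMap.

(** * A rational pseudo-reflection *)

Section Reflection.
Variables (F : fieldType) (l k1 k : nat).

Definition congr_mx : 'M[F]_k := \matrix_(i, j) (i == j %[mod k1])%N%:R.

(** For k = l k1, l^-1 times congr_mx is the projection P that averages over the
    residue classes mod k1, and this is 1 + (w - 1) P: it multiplies the image
    of P by w and fixes its kernel. *)
Definition reflection_mx (w : F) : 'M[F]_k :=
  1%:M + ((w - 1) / l%:R) *: congr_mx.

Hypothesis Dk : k = (l * k1)%N.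

Lemma congr_mx_sqr : congr_mx *m congr_mx = l%:R *: congr_mx.
Proof.
have [k1_0 | k1_gt0] := posnP k1.
  by apply/matrixP=> -[i lt_i]; exfalso; move: lt_i; rewrite Dk k1_0 muln0.
apply/matrixP=> i j; rewrite !mxE.
transitivity ((i == j %[mod k1])%:R * \sum_(r < k) (r == i %[mod k1])%:R : F).
  rewrite mulr_sumr; apply: eq_bigr => r _; rewrite !mxE.
  rewrite -!natrM !mulnb; congr (_%:R); congr nat_of_bool.
  rewrite [(i %% k1 == r %% k1)%N]eq_sym andbC.
  by case: (r %% k1 =P i %% k1)%N => [->|_]; rewrite ?andbF.
rewrite mulrC; congr (_ * _).
rewrite -(big_mkord xpredT (fun r => (r == i %[mod k1])%N%:R)).
move: (nat_of_ord i) => c; rewrite Dk big_nat_mul.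
rewrite -[l in RHS]subn0 -sumr_const_nat; apply: eq_big_nat => t _.
rewrite -[(t * k1)%N]add0n big_addn mulSn addnK big_mkord.
rewrite (bigD1 (Ordinal (ltn_pmod c k1_gt0))) //= addnC modnMDl modn_mod eqxx.
rewrite big1 ?addr0 // => r; rewrite -val_eqE /= addnC modnMDl.
by rewrite (modn_small (ltn_ord r)) => /negbTE->.
Qed.

Lemma reflection_mxM w w' : l%:R != 0 :> F ->
  reflection_mx w *m reflection_mx w' = reflection_mx (w * w').
Proof.
move=> nz_l; rewrite mulmxDl mul1mx mulmxDr mulmx1 -scalemxAl -scalemxAr.
rewrite congr_mx_sqr -addrA; congr (_ + _).
by rewrite !scalerA -!scalerDl; congr (_ *: _); field.
Qed.

Lemma reflection_mx1 : reflection_mx 1 = 1%:M.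
Proof. by rewrite /reflection_mx subrr mul0r scale0r addr0. Qed.

Lemma tr_reflection_mx w : (reflection_mx w)^T = reflection_mx w.
Proof.
rewrite raddfD /= tr_scalar_mx linearZ /=; congr (_ + _ *: _).
by apply/matrixP=> i j; rewrite !mxE eq_sym.
Qed.

(** Translation by 1 preserves congruence mod k1, also across the wrap-around
    since k1 divides k. *)
Lemma cycle_reflection_mx w :
  cycle_mx F k *m reflection_mx w = reflection_mx w *m cycle_mx F k.
Proof.
set c := cycle_mx F k.
rewrite mulmxDl mulmxDr mulmx1 mul1mx -scalemxAl -scalemxAr; congr (_ + _ *: _).
(* conjugation by c shifts both indices of congr_mx *)
have cJc : c^T *m congr_mx *m c = congr_mx.
  rewrite /c cycle_mxE trmxK -row_permE tr_perm_mx -col_permE.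
  apply/matrixP=> i j; rewrite !mxE !permE /=.
  have dvd_k1 : (k1 %| k)%N by rewrite Dk dvdn_mull.
  rewrite !(modn_dvdm _ dvd_k1).
  by rewrite -[i.+1]addn1 -[j.+1]addn1 eqn_modDr.
by rewrite -[in LHS]cJc !mulmxA cycle_mx_orthogonal mul1mx.
Qed.

Lemma diag_reflection_mx (d : 'rV_k) w :
  (forall i j : 'I_k, i = j %[mod k1] -> d 0 i = d 0 j) ->
  diag_mx d *m reflection_mx w = reflection_mx w *m diag_mx d.
Proof.
move=> per_d; apply/matrixP=> i j; rewrite mul_diag_mx mul_mx_diag !mxE.
case: (i =P j) => [->|_]; first by rewrite mulrC.
have [/eqP/per_d->|_] := boolP (i == j %[mod k1]); first by rewrite mulrC.
by rewrite mulr0 addr0 mulr0 mul0r.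
Qed.

End Reflection.

Section FrobReflection.
Variables (Fq : finFieldType) (Fbar : closedFieldType).
Variable iota : {rmorphism Fq -> Fbar}.
Variable eta : int.

(** The entrywise power sends the reflection of parameter w to that of
    parameter w^q.  If eta = -1 then w^q = w^-1, and the latter is the inverse
    of the former, which is symmetric. *)
Lemma Frob_reflection_mx l k1 k (w : Fbar) :
  k = (l * k1)%N -> l%:R != 0 :> Fbar -> w != 0 ->
  twisted_expq Fq eta w = w ->
  Frob Fq eta (reflection_mx l k1 k w) = reflection_mx l k1 k w.
Proof.
move=> Dk nz_l nz_w fix_w.
have Fqr : entrywise_q Fq (reflection_mx l k1 k w)
    = reflection_mx l k1 k (w ^+ #|Fq|).
  apply/matrixP=> i j; rewrite !mxE (expqD iota) !exprMn !(expq_nat iota).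
  by rewrite (expqD iota) (expqN iota) expr1n exprVn (expq_nat iota).
move: fix_w; rewrite /twisted_expq /Frob Fqr.
case: ifP => _ Dw; first by rewrite Dw.
have {}Dw : w ^+ #|Fq| = w^-1 by rewrite -[X in _ = X^-1]Dw invrK.
have E : reflection_mx l k1 k w^-1 *m reflection_mx l k1 k w = 1%:M.
  by rewrite (reflection_mxM Dk) // mulVf // reflection_mx1.
have [uw _] := mulmx1_unit E.
by rewrite Dw -[invmx _]mulmx1 -E mulKmx // tr_reflection_mx.
Qed.

End FrobReflection.

(** * Change of frame *)

Section Frame.
Variables (Fq : finFieldType) (Fbar : closedFieldType).
Variable iota : {rmorphism Fq -> Fbar}.
Variable eta : int.
Variables (k n N : nat) (eN : (k * n)%N = N) (g1 : 'M[Fbar]_k).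
Local Notation Frob := (@Frob Fq Fbar eta _).

Definition frame (B : 'M[Fbar]_(k * n)) : 'M[Fbar]_N :=
  let g := tens (1%:M : 'M_n) g1 in castmx (eN, eN) (g *m B *m invmx g).

Hypothesis g1_unit : g1 \in unitmx.

Let g_unit : tens (1%:M : 'M_n) g1 \in unitmx.
Proof. by rewrite tensmx_unitmx ?unitmx1. Qed.

Lemma frameM A B : frame (A *m B) = frame A *m frame B.
Proof.
rewrite /frame; case: N / eN; rewrite /= !castmx_id.
by rewrite !mulmxA; congr (_ *m _ *m _); rewrite mulmxKV.
Qed.

Lemma frame1 : frame 1%:M = 1%:M.
Proof. by rewrite /frame; case: N / eN; rewrite castmx_id mulmx1 mulmxV. Qed.

Lemma frameZ c A : frame (c *: A) = c *: frame A.
Proof.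
rewrite /frame; case: N / eN; rewrite /= !castmx_id.
by rewrite -scalemxAr -scalemxAl.
Qed.

Lemma det_frame A : \det (frame A) = \det A.
Proof.
rewrite /frame det_castmx !det_mulmx mulrAC -det_mulmx mulmxV //.
by rewrite det1 mul1r.
Qed.

Lemma frame_inj : injective frame.
Proof.
move=> A B; rewrite /frame; case: N / eN; rewrite /= !castmx_id.
have := g_unit; set g := tens _ _ => ug /(congr1 (mulmxr g)) /=.
rewrite !mulmxKV // => /(congr1 (mulmx (invmx g))).
by rewrite !mulKmx.
Qed.

Lemma frame_unit A : A \in unitmx -> frame A \in unitmx.
Proof. by rewrite !unitmxE det_frame. Qed.

Hypothesis g1_twist : invmx g1 *m Frob g1 = cycle_mx Fbar k.

(** With W = g^-1 F(g) one has F(g B g^-1) = g W F(B) W^-1 g^-1. *)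
Lemma frame_Frob B : B \in unitmx ->
  (cycle_mx Fbar k *t 1%:M) *m Frob B = B *m (cycle_mx Fbar k *t 1%:M) ->
  Frob (frame B) = frame B.
Proof.
move=> uB cB; rewrite /frame Frob_castmx; congr castmx.
have := g_unit; set g := tens _ _ => ug.
have Fg : Frob g = g *m (cycle_mx Fbar k *t 1%:M).
  rewrite Frob_tens ?unitmx1 // (Frob1 iota) /g /tens tensmx_mul mulmx1.
  by rewrite -g1_twist mulKVmx.
have uFg : Frob g \in unitmx by rewrite (Frob_unit iota).
have ugBg : g *m B *m invmx g \in unitmx.
  by rewrite !unitmx_mul ug uB unitmx_inv.
apply: (can_inj (mulmxK uFg)); rewrite -(FrobM iota) // mulmxKV //.
by rewrite (FrobM iota) // Fg -!mulmxA cB mulKmx.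
Qed.

(** The cyclic matrix shifts the diagonal entries by one place, which is undone
    by applying f to them. *)
Lemma frame_twisted_diag (f : Fbar -> Fbar) (d : 'rV_k) (e : 'M_n) :
  Frob (diag_mx d) = diag_mx (map_mx f d) -> diag_mx d \in unitmx ->
  (forall i : 'I_k, f (d 0 i) = d 0 (ordS i)) ->
  Frob e = e -> e \in unitmx ->
  Frob (frame (diag_mx d *t e)) = frame (diag_mx d *t e).
Proof.
move=> Fd ud df Fe ue; apply: frame_Frob; first exact: tensmx_unitmx.
rewrite Frob_tens // Fd Fe !tensmx_mul mulmx1 mul1mx; congr (_ *t _).
apply/matrixP=> i j; rewrite mul_mx_diag mul_diag_mx !mxE df.
case: eqP => [Ei|_]; last by rewrite mul0r mulr0.
by rewrite mulrC; congr (d 0 _ * _); apply: val_inj.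
Qed.

End Frame.

Section Blocks.
Variables (Fq : finFieldType) (Fbar : closedFieldType).
Variable iota : {rmorphism Fq -> Fbar}.
Variable eta : int.
Variables (L Q : nat).
Hypothesis twistQ :
  forall x : Fbar, x ^+ L = 1 -> twisted_expq Fq eta x = x ^+ Q.
Hypothesis L_gt0 : (0 < L)%N.
Local Notation Frob := (@Frob Fq Fbar eta _).

Lemma root1_neq0 (c : Fbar) : c ^+ L = 1 -> c != 0.
Proof.
by apply: contra_eq_neq => ->; rewrite expr0n gtn_eqF // eq_sym oner_neq0.
Qed.

Lemma root1X (c : Fbar) s : c ^+ L = 1 -> (c ^+ s) ^+ L = 1.
Proof. by rewrite exprAC => ->; rewrite expr1n. Qed.

Lemma Frob_root_diag_mx n (d : 'rV[Fbar]_n) : (forall i, d 0 i ^+ L = 1) ->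
  Frob (diag_mx d) = diag_mx (map_mx (fun x => x ^+ Q) d).
Proof.
move=> dL; rewrite Frob_diag_mx => [|i]; last exact: root1_neq0.
by congr diag_mx; apply/rowP=> i; rewrite !mxE twistQ.
Qed.

Lemma Frob_scale n (c : Fbar) (e : 'M_n) : c ^+ L = 1 -> e \in unitmx ->
  Frob (c *: e) = c ^+ Q *: Frob e.
Proof.
move=> cL ue; rewrite -!mul_scalar_mx (FrobM iota) //; last first.
  by rewrite unitmxE det_scalar unitrX // unitfE root1_neq0.
congr (_ *m _); rewrite -!diag_const_mx Frob_root_diag_mx => [|i].
  by congr diag_mx; apply/rowP=> i; rewrite !mxE.
by rewrite mxE.
Qed.

Lemma iter_Frob_scale n s (c : Fbar) (e : 'M_n) :
  c ^+ L = 1 -> e \in unitmx -> Frob e = e ->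
  iter s (@Defs.Frob Fq Fbar eta n) (c *: e) = c ^+ (Q ^ s) *: e.
Proof.
move=> cL ue Fe; elim: s => [|s IHs]; first by rewrite expr1.
by rewrite iterS IHs Frob_scale ?root1X // Fe -exprM expnSr.
Qed.

Definition twist_row k (c : Fbar) : 'rV[Fbar]_k := \row_i c ^+ (Q ^ i).

Lemma blockdiag_scale k n (c : Fbar) (e : 'M_n) :
  c ^+ L = 1 -> e \in unitmx -> Frob e = e ->
  blockdiag k (fun i => iter i (@Defs.Frob Fq Fbar eta n) (c *: e))
    = diag_mx (twist_row k c) *t e.
Proof.
move=> cL ue Fe; apply/matrixP=> i j.
case: (mxtens_indexP i) => i0 i1; case: (mxtens_indexP j) => j0 j1.
rewrite tensmxE summxE (bigD1 i0) //= big1 ?addr0 => [|t ne_t].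
  rewrite iter_Frob_scale // tensmxE !mxE eqxx /= eq_sym.
  by case: eqP => _; rewrite /= ?mulr1n ?mulr0n ?mul0r ?mul1r.
by rewrite tensmxE mxE eq_sym (negbTE ne_t) mul0r.
Qed.

Lemma det_diag_tens k n (c : Fbar) (e : 'M_n) : \det e = 1 ->
  \det (diag_mx (twist_row k c) *t e) = c ^+ ((\sum_(s < k) Q ^ s) * n).
Proof.
move=> de; rewrite det_tensmx de expr1n mulr1 det_diag exprM; congr (_ ^+ _).
by rewrite -prodrXr; apply: eq_bigr => i _; rewrite mxE.
Qed.

End Blocks.

(** * Elements of the basic subgroup *)

Section BasicSubgroup.
Variables (Fq : finFieldType) (Fbar : closedFieldType).
Variables (iota : {rmorphism Fq -> Fbar}) (eta : int).
Variables (l m alpha gamma : nat) (l_pr : prime l) (zeta : Fbar).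
Variable g1 : 'M[Fbar]_(l ^ alpha).
Local Notation a := (nu_qeta Fq eta l).
Local Notation L := (l ^ (a + alpha))%N.
Local Notation k := (l ^ alpha)%N.
Local Notation n := (l ^ gamma * m)%N.
Local Notation N := (m * l ^ (alpha + gamma))%N.
Local Notation R0 := (basic_R0 iota eta m alpha gamma l_pr zeta).
Local Notation Rt := (basic_subgroup iota eta m alpha gamma l_pr zeta g1).
Local Notation GLk := (GLfix iota eta n (prime_exp_gt0 alpha l_pr)).
Local Notation GL := (GL_eta iota eta N).
Local Notation Frob := (@Frob Fq Fbar eta _).
Local Notation basic_frame := (frame (basic_dim l m alpha gamma) g1).

Hypotheses (l_odd : odd l) (m_gt0 : (0 < m)%N) (a_gt0 : (0 < a)%N).
Hypothesis zeta_prim : L.-primitive_root zeta.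
Hypothesis g1_unit : g1 \in unitmx.
Hypothesis g1_twist : invmx g1 *m Frob g1 = cycle_mx Fbar k.
Variable Q : nat.
Hypotheses (Q1_gt0 : (0 < Q.-1)%N) (logQ : logn l Q.-1 = a).
Hypothesis twistQ :
  forall x : Fbar, x ^+ L = 1 -> twisted_expq Fq eta x = x ^+ Q.

Let l_gt0 : (0 < l)%N := prime_gt0 l_pr.
Let L_gt0 : (0 < L)%N. Proof. by rewrite expn_gt0 l_gt0. Qed.
Let Q_gt0 : (0 < Q)%N. Proof. exact: leq_trans Q1_gt0 (leq_pred Q). Qed.
Let l_dvd_Q1 : (l %| Q.-1)%N.
Proof. by rewrite -[l]expn1 pfactor_dvdn // logQ. Qed.
Let zetaL : zeta ^+ L = 1. Proof. exact: prim_expr_order. Qed.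

(** The valuation of i (Q^(l^j) - 1) is nu(i) + a + j. *)
Lemma zeta_expQ_eq i j : (0 < i)%N ->
  (zeta ^+ (i * Q ^ (l ^ j)) == zeta ^+ i) = (alpha <= logn l i + j)%N.
Proof.
move=> i_gt0; rewrite (eq_prim_root_expr zeta_prim) eqn_mod_dvd; last first.
  by rewrite leq_pmulr // expn_gt0 Q_gt0.
have -> : (i * Q ^ (l ^ j) - i = i * (Q ^ (l ^ j)).-1)%N.
  by rewrite -subn1 mulnBr muln1.
have Qj_gt0 : (0 < (Q ^ (l ^ j)).-1)%N.
  by rewrite predn_exp muln_gt0 Q1_gt0 geometric_gt0 // expn_gt0 l_gt0.
rewrite pfactor_dvdn ?muln_gt0 ?i_gt0 // lognM // logn_expn_pred // logQ.
by rewrite addnCA leq_add2l.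
Qed.

Lemma zeta_fix_expQk i : zeta ^+ (i * Q ^ k) = zeta ^+ i.
Proof.
apply/eqP; have [->|i_gt0] := posnP i; first by rewrite mul0n.
by rewrite zeta_expQ_eq // leq_addl.
Qed.

(** A field of characteristic l has no primitive root of unity of order
    divisible by l. *)
Lemma natr_l_neq0 : l%:R != 0 :> Fbar.
Proof.
apply/negP=> l0; have: (l \in [pchar Fbar]) by apply/andP.
rewrite (prim_root_pcharF zeta_prim) // -{1}[l]expn1.
by rewrite dvdn_exp2l // addn_gt0 a_gt0.
Qed.

Definition zeta_l : Fbar := zeta ^+ (l ^ (a + alpha - 1)).

Let LE : L = (l ^ (a + alpha - 1) * l)%N.
Proof. by rewrite -expnSr subn1 prednK // addn_gt0 a_gt0. Qed.

Lemma zeta_l_expl : zeta_l ^+ l = 1.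
Proof. by rewrite -exprM -LE. Qed.

Lemma zeta_l_neq1 : zeta_l != 1.
Proof.
rewrite /zeta_l -(prim_order_dvd zeta_prim) LE -{2}[(l ^ _)%N]muln1.
by rewrite dvdn_pmul2l ?expn_gt0 ?l_gt0 // dvdn1 gtn_eqF ?prime_gt1.
Qed.

Lemma zeta_l_expL : zeta_l ^+ L = 1.
Proof. by rewrite LE mulnC exprM zeta_l_expl expr1n. Qed.

Lemma zeta_l_expQ i : (zeta_l ^+ i) ^+ Q = zeta_l ^+ i.
Proof.
have [c Dc] := dvdnP l_dvd_Q1.
rewrite -(prednK Q_gt0) exprS Dc mulnC exprM [X in X ^+ c]exprAC zeta_l_expl.
by rewrite !expr1n mulr1.
Qed.

Lemma Frob_basic_x :
  Frob (basic_x Fq eta l alpha zeta) = basic_x Fq eta l alpha zeta.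
Proof.
rewrite (Frob_root_diag_mx twistQ L_gt0) => [|i]; last first.
  by rewrite mxE root1X ?zeta_l_expL.
by congr diag_mx; apply/rowP=> i; rewrite !mxE zeta_l_expQ.
Qed.

Lemma det_basic_x : \det (basic_x Fq eta l alpha zeta) = 1.
Proof.
rewrite det_diag; under eq_bigr do rewrite mxE.
rewrite prodrXr -(big_mkord xpredT id) bin2_sum.
have /dvdnP[c ->] : (l %| 'C(l, 2))%N.
  by apply: prime_dvd_bin; rewrite ?odd_prime_gt2.
by rewrite mulnC exprM zeta_l_expl expr1n.
Qed.

Lemma zeta_mx_fixed :
  ((zeta%:M : 'M_n) \in unitmx) &&
  (iter k (@Defs.Frob Fq Fbar eta n) zeta%:M == zeta%:M).
Proof.
have z1 : zeta%:M = zeta *: (1%:M : 'M_n) by rewrite scalemx1.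
rewrite unitmxE det_scalar unitrX ?unitfE ?(root1_neq0 L_gt0) //=.
rewrite z1 (iter_Frob_scale iota twistQ) ?unitmx1 ?(Frob1 iota) //.
by have := zeta_fix_expQk 1; rewrite mul1n expr1 => ->.
Qed.

Definition zeta_GL : GLk :=
  MkGLfix iota (prime_exp_gt0 alpha l_pr) zeta_mx_fixed.

Lemma zeta_GLX i (A : GLk) : glval (zeta_GL ^+ i * A)%g = zeta ^+ i *: glval A.
Proof.
elim: i => [|i IHi]; first by rewrite expg0 mul1g scale1r.
by rewrite expgS -mulgA exprS -scalerA -IHi -mul_scalar_mx.
Qed.

Definition fixed_det1 : {set GLk} :=
  [set A : GLk | (Frob (glval A) == glval A) && (\det (glval A) == 1)].

Lemma fixed_det1_group_set : group_set fixed_det1.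
Proof.
apply/group_setP; split=> [|A B].
  by rewrite inE /= (Frob1 iota) det1 !eqxx.
rewrite !inE /= (FrobM iota) ?glval_unit // det_mulmx.
by move=> /andP[/eqP-> /eqP->] /andP[/eqP-> /eqP->]; rewrite mulr1 !eqxx.
Qed.
Canonical fixed_det1_group := Group fixed_det1_group_set.

Lemma at_pos_generator (X : 'M[Fbar]_l) j : Frob X = X -> \det X = 1 ->
  Frob (tens (1%:M : 'M_m) (at_pos gamma j X)) = tens 1%:M (at_pos gamma j X) /\
  \det (tens (1%:M : 'M_m) (at_pos gamma j X)) = 1.
Proof.
move=> FX dX.
have [FY dY] : Frob (at_pos gamma j X) = at_pos gamma j X /\
    \det (at_pos gamma j X) = 1.
  apply: (bigtens_Frob_det1 iota) => i; case: ifP => // _.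
  by rewrite (Frob1 iota) det1.
rewrite /tens Frob_tens ?unitmx1 ?det1_unitmx // FY (Frob1 iota).
by rewrite det_tensmx dY det1 !expr1n mulr1.
Qed.

(** The generators of R^0 other than zeta are fixed by F and have determinant 1,
    and zeta is central. *)
Lemma basic_R0_decomposition (A : GLk) : A \in R0 ->
  exists i, exists2 e : GLk, e \in R0 :&: fixed_det1 & A = (zeta_GL ^+ i * e)%g.
Proof.
have zR0 : zeta_GL \in R0 by apply: mem_gen; rewrite inE /= eqxx.
have cz : <[zeta_GL]>%g \subset 'C(R0 :&: fixed_det1)%g.
  rewrite cycle_subG; apply/centP=> e _; apply: val_inj => /=.
  by rewrite scalar_mxC.
have sR0 : R0 \subset (<[zeta_GL]> * (R0 :&: fixed_det1))%g.
  rewrite -(cent_joinEl cz) {1}/basic_R0 gen_subG.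
  apply/subsetP=> B; rewrite inE => DB.
  have BR0 : B \in R0 by apply: mem_gen; rewrite inE.
  case/or3P: DB => [/eqP DB | /existsP[j /eqP DB] | /existsP[j /eqP DB]].
  - rewrite (_ : B = zeta_GL) ?mem_gen ?inE ?cycle_id //.
    exact: val_inj.
  - rewrite mem_gen // inE; apply/orP; right; rewrite !inE BR0 /= DB.
    have [-> ->] := at_pos_generator j Frob_basic_x det_basic_x.
    by rewrite !eqxx.
  rewrite mem_gen // inE; apply/orP; right; rewrite !inE BR0 /= DB.
  have [-> ->] :=
    at_pos_generator j (Frob_cycle_mx iota eta l) (det_cycle_mx _ l_odd).
  by rewrite !eqxx.
move/(subsetP sR0)/mulsgP=> [_ e /cycleP[i ->] Re ->].
by exists i, e.
Qed.

Definition embedding (c : Fbar) (e : 'M[Fbar]_n) : 'M[Fbar]_N :=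
  basic_frame (diag_mx (twist_row Q k c) *t e).

Lemma zetaX_expL i : (zeta ^+ i) ^+ L = 1.
Proof. exact: root1X. Qed.

Lemma basic_conj_embedding i (e : GLk) : e \in fixed_det1 ->
  basic_conj Fq eta g1 (glval (zeta_GL ^+ i * e)%g)
    = embedding (zeta ^+ i) (glval e).
Proof.
rewrite inE => /andP[/eqP Fe /eqP de]; rewrite zeta_GLX /embedding.
by rewrite -(blockdiag_scale iota twistQ L_gt0 k) ?zetaX_expL ?det1_unitmx.
Qed.

Lemma twist_row_unit i : diag_mx (twist_row Q k (zeta ^+ i)) \in unitmx.
Proof.
rewrite unitmxE det_diag unitr_prod // => j _.
by rewrite mxE -exprM unitrX // unitfE (root1_neq0 L_gt0).
Qed.

Lemma embedding_fixed i (e : GLk) : e \in fixed_det1 ->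
  (embedding (zeta ^+ i) e \in unitmx) &&
  (iter 1 (@Defs.Frob Fq Fbar eta N) (embedding (zeta ^+ i) e)
     == embedding (zeta ^+ i) e).
Proof.
rewrite inE => /andP[/eqP Fe /eqP de].
rewrite frame_unit ?tensmx_unitmx ?twist_row_unit ?(det1_unitmx de) //=.
apply/eqP.
apply: (frame_twisted_diag iota (f := fun x => x ^+ Q) _ g1_unit g1_twist).
- apply: (Frob_root_diag_mx twistQ L_gt0) => j; rewrite mxE.
  exact/root1X/zetaX_expL.
- exact: twist_row_unit.
- move=> j; rewrite !mxE -[LHS]exprM -expnSr -!exprM /=.
  (* at the last place the shift wraps around, which is harmless as F^k fixes
     the powers of zeta *)
  have: (j.+1 <= k)%N by [].
  rewrite leq_eqVlt => /predU1P[->|lt_j]; last by rewrite modn_small.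
  by rewrite modnn zeta_fix_expQk muln1.
- exact: Fe.
exact: det1_unitmx.
Qed.

Definition embedding_GL i (e : GLk) (Ke : e \in fixed_det1) : GL :=
  MkGLfix iota (ltn0Sn 0) (embedding_fixed i Ke).

Lemma basic_subgroupP (X : GL) :
  reflect (exists i, exists2 e : GLk, e \in R0 :&: fixed_det1
                         & glval X = embedding (zeta ^+ i) (glval e))
          (X \in Rt).
Proof.
have zR0 : zeta_GL \in R0 by apply: mem_gen; rewrite inE /= eqxx.
rewrite inE; apply: (iffP exists_inP) => [[A /basic_R0_decomposition] | ].
  move=> [i [e Re ->]] /eqP ->; exists i, e => //.
  by case/setIP: Re => _ Ke; rewrite basic_conj_embedding.
move=> [i [e /setIP[Re Ke] DX]]; exists (zeta_GL ^+ i * e)%g.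
  by rewrite groupM ?groupX.
by rewrite basic_conj_embedding // DX.
Qed.

(** The exponent of zeta is i (1 + Q + ... + Q^(k-1)) n, whose valuation is
    nu(i) + alpha + gamma + nu(m).  The case i = 0 is apart because logn l 0
    is 0. *)
Lemma det_embedding i (e : GLk) : e \in fixed_det1 ->
  (\det (embedding (zeta ^+ i) (glval e)) == 1)
     = (i == 0%N) || (a <= logn l i + (gamma + logn l m))%N.
Proof.
rewrite inE => /andP[_ /eqP de]; rewrite det_frame // det_diag_tens // -exprM.
rewrite -(prim_order_dvd zeta_prim).
have [->|i_gt0] := posnP i; first by rewrite mul0n dvdn0.
have sum_gt0 : (0 < \sum_(s < k) Q ^ s)%N.
  by rewrite geometric_gt0 // expn_gt0 l_gt0.
have lg_gt0 : (0 < l ^ gamma)%N by rewrite expn_gt0 l_gt0.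
rewrite pfactor_dvdn ?muln_gt0 ?i_gt0 ?sum_gt0 ?lg_gt0 //.
rewrite !lognM ?muln_gt0 ?sum_gt0 ?lg_gt0 // logn_geometric // pfactorK //.
by rewrite addnCA [X in (X <= _)%N]addnC leq_add2l.
Qed.

(** * Specialness *)

Lemma SL_norm : [set: GL] \subset 'N(SL_eta iota eta N)%g.
Proof.
apply/subsetP=> h _; rewrite inE; apply/subsetP=> _ /imsetP[X dX ->].
move: dX; rewrite !inE /= => /eqP dX.
by rewrite !det_mulmx dX mul1r -det_mulmx mulVmx ?glval_unit // det1.
Qed.

Lemma special_of_subset : radical_subgroup l [set: GL] Rt ->
  Rt \subset SL_eta iota eta N ->
  special_subgroup l [set: GL] (SL_eta iota eta N) Rt.
Proof.
move=> radR sRG; rewrite /special_subgroup radR (setIidPl sRG).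
by case/and3P: radR.
Qed.

Lemma basic_subgroup_sub_SL : (a <= gamma + logn l m)%N ->
  Rt \subset SL_eta iota eta N.
Proof.
move=> le_a; apply/subsetP=> X /basic_subgroupP[i [e /setIP[_ Ke] DX]].
rewrite inE DX det_embedding //; apply/orP; right.
exact: leq_trans le_a (leq_addl _ _).
Qed.

(** For alpha = 0 there is a single block, so c enters as a scalar. *)
Lemma embedding_alpha0 c e : alpha = 0%N -> embedding c e = c *: embedding 1 e.
Proof.
move=> alpha0; rewrite /embedding -frameZ; congr (basic_frame _).
have Q0 (s : 'I_k) : (Q ^ s = 1)%N.
  by have := ltn_ord s; move: (nat_of_ord s) => t; rewrite alpha0; case: t.
apply/matrixP=> i j; case: (mxtens_indexP i) => i0 i1.
case: (mxtens_indexP j) => j0 j1; rewrite [in RHS]mxE !tensmxE !mxE !Q0 !expr1.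
by rewrite mulrA mulrnAr mulr1.
Qed.

(** Every X in R is a scalar element Z of R times an element E of R :&: G.  Since
    Z is central, whatever normalises R :&: G normalises R. *)
Lemma special_alpha0 : alpha = 0%N -> radical_subgroup l [set: GL] Rt ->
  special_subgroup l [set: GL] (SL_eta iota eta N) Rt.
Proof.
move=> alpha0 radR; rewrite /special_subgroup radR /=.
set G := SL_eta iota eta N; case/and3P: radR => _ _ /eqP DR.
have RM : {in Rt &, forall X Y, (X * Y)%g \in Rt}.
  by move=> X Y; rewrite {1 2}DR => RX RY; rewrite DR groupM.
suff <- : ('N_[set: GL](Rt) = 'N_[set: GL](Rt :&: G))%g by apply/eqP.
apply/eqP; rewrite eqEsubset !subsetI !subsetT /= !setTI; apply/andP; split.
  rewrite normsI // (subset_trans (subsetT _)) //.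
  exact: SL_norm.
apply/subsetP=> h Nh; rewrite inE; apply/subsetP=> _ /imsetP[X RX ->].
have [i [e Re DX]] := basic_subgroupP X RX; have [_ Ke] := setIP Re.
have K1 : (1%g : GLk) \in fixed_det1 by rewrite group1.
pose Z := embedding_GL i K1; pose E := embedding_GL 0 Ke.
have RZ : Z \in Rt.
  by apply/basic_subgroupP; exists i, 1%g; first exact: group1.
have RE : E \in Rt by apply/basic_subgroupP; exists 0%N, e.
have GE : E \in G by rewrite inE det_embedding.
have emb1 : embedding 1 1%:M = 1%:M.
  rewrite /embedding -[RHS](frame1 (basic_dim l m alpha gamma) g1_unit).
  congr (basic_frame _).
  rewrite -[RHS]tensmx11 -[X in _ = X *t _]diag_const_mx.
  congr (diag_mx _ *t _).
  by apply/rowP=> s; rewrite !mxE expr1n.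
have -> : (X ^ h = Z * E ^ h)%g.
  apply: val_inj; rewrite /= DX embedding_alpha0 //.
  rewrite [embedding _ 1%:M]embedding_alpha0 //.
  by rewrite emb1 scalemx1 mul_scalar_mx -scalemxAl -scalemxAr expr0.
apply: RM => //; have: (E ^ h)%g \in Rt :&: G by rewrite memJ_norm // inE RE.
by case/setIP.
Qed.

Lemma twist_row_periodic (c : Fbar) k1 i : c ^+ (Q ^ k1) = c ->
  c ^+ (Q ^ i) = c ^+ (Q ^ (i %% k1)).
Proof.
move=> per_c; rewrite {1}(divn_eq i k1); elim: (i %/ k1)%N => // t IHt.
by rewrite mulSn -addnA expnD exprM per_c.
Qed.

Lemma twisted_zeta_l : twisted_expq Fq eta zeta_l = zeta_l.
Proof. by rewrite twistQ ?zeta_l_expL // -[zeta_l]expr1 zeta_l_expQ. Qed.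

Lemma reflection_fixed k1 : k = (l * k1)%N ->
  (basic_frame (reflection_mx l k1 k zeta_l *t 1%:M) \in unitmx) &&
  (iter 1 (@Defs.Frob Fq Fbar eta N)
          (basic_frame (reflection_mx l k1 k zeta_l *t 1%:M))
     == basic_frame (reflection_mx l k1 k zeta_l *t 1%:M)).
Proof.
move=> Dk; have nz_z : zeta_l != 0 by apply: (root1_neq0 L_gt0 zeta_l_expL).
have MV : reflection_mx l k1 k zeta_l *m reflection_mx l k1 k zeta_l^-1 = 1%:M.
  by rewrite (reflection_mxM Dk) ?natr_l_neq0 // mulfV // reflection_mx1.
have [uM _] := mulmx1_unit MV.
rewrite frame_unit ?tensmx_unitmx ?unitmx1 //=; apply/eqP.
apply: (frame_Frob iota _ g1_unit g1_twist).
  by rewrite tensmx_unitmx ?unitmx1.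
rewrite Frob_tens ?unitmx1 // (Frob1 iota).
rewrite (Frob_reflection_mx iota Dk) ?natr_l_neq0 ?twisted_zeta_l //.
by rewrite !tensmx_mul (cycle_reflection_mx Dk).
Qed.

(** R would be normal in N(R :&: G), hence normalised by the pseudo-reflection
    h, which centralises R :&: G.  But the conjugate by h of the element Y of R
    coming from zeta is not block diagonal, so it is not in R. *)
Lemma not_special : (0 < alpha)%N -> (gamma + logn l m < a)%N ->
  ~~ special_subgroup l [set: GL] (SL_eta iota eta N) Rt.
Proof.
move=> alpha_gt0 lt_a; apply/negP=> /andP[_ /eqP DR].
set G := SL_eta iota eta N in DR.
pose k1 := (l ^ alpha.-1)%N.
have Dk : k = (l * k1)%N by rewrite -expnS prednK.
have k1_gt0 : (0 < k1)%N by rewrite expn_gt0 l_gt0.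
set M := reflection_mx l k1 k zeta_l.
pose h : GL := MkGLfix iota (ltn0Sn 0) (reflection_fixed Dk).
have Nh : h \in 'N_[set: GL](Rt :&: G)%g.
  rewrite setTI; apply: (subsetP (cent_sub _)); apply/centP=> X /setIP[RX GX].
  have [i [e /setIP[_ Ke] DX]] := basic_subgroupP X RX.
  apply: val_inj; rewrite /= DX /embedding.
  rewrite -!(frameM (basic_dim l m alpha gamma) g1_unit) !tensmx_mul.
  rewrite mul1mx mulmx1; congr (basic_frame (_ *t _)).
  apply/esym/diag_reflection_mx => s t eq_st; rewrite !mxE.
  (* determinant 1 forces l to divide i, which costs one factor l in the order
     of zeta^i *)
  have per_i : (zeta ^+ i) ^+ (Q ^ k1) = zeta ^+ i.
    rewrite -exprM; apply/eqP; have [->|i_gt0] := posnP i.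
      by rewrite mul0n.
    move: GX; rewrite inE DX det_embedding // (gtn_eqF i_gt0) /= => le_a.
    rewrite zeta_expQ_eq // -ltnS -addnS prednK //.
    rewrite -[X in (X < _)%N]add0n ltn_add2r.
    by rewrite -(ltn_add2r (gamma + logn l m)); apply: leq_trans lt_a le_a.
  by rewrite (twist_row_periodic s per_i) (twist_row_periodic t per_i) eq_st.
have K1 : (1%g : GLk) \in fixed_det1 by rewrite group1.
pose Y := embedding_GL 1 K1.
have RY : Y \in Rt.
  by apply/basic_subgroupP; exists 1%N, 1%g; first exact: group1.
have: (Y ^ h)%g \in Rt.
  rewrite {1}DR memJ_norm -?DR //; have := Nh; apply/subsetP.
  rewrite {2}DR; exact: normal_norm (pcore_normal _ _).
case/basic_subgroupP=> i [e _ DYh].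
have: glval Y *m glval h = glval h *m glval (Y ^ h)%g.
  by rewrite /= mulKVmx ?(glval_unit h).
rewrite DYh /= /embedding.
rewrite -!(frameM (basic_dim l m alpha gamma) g1_unit) !tensmx_mul.
move/(frame_inj g1_unit) => E.
(* Compare the entries of E in column 0 and rows k1 and 2 k1: M has two
   nonzero off-diagonal entries there, because l >= 3. *)
have k1_lt t : (t < 3)%N -> (t * k1 < k)%N.
  by move=> t_lt; rewrite Dk ltn_pmul2r // (leq_trans t_lt) // odd_prime_gt2.
have n_gt0 : (0 < n)%N by rewrite muln_gt0 expn_gt0 l_gt0.
pose idx t (lt_t : (t < 3)%N) := Ordinal (k1_lt t lt_t).
pose o := Ordinal n_gt0.
have Et t (lt_t : (t < 3)%N) : (0 < t)%N ->
    zeta ^+ (Q ^ (t * k1)) = zeta ^+ i * glval e o o.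
  move=> t_gt0.
  have := congr1 (fun A : 'M_(k * n) =>
    A (mxtens_index (idx t lt_t, o)) (mxtens_index (idx 0%N isT, o))) E.
  rewrite !tensmxE mul_diag_mx mul_mx_diag !mul1mx !mxE eqxx mulr1 /=.
  have M_neq0 : (zeta_l - 1) / l%:R != 0.
    by rewrite mulf_neq0 ?invr_eq0 ?natr_l_neq0 // subr_eq0 zeta_l_neq1.
  rewrite -val_eqE /= !mul0n muln_eq0 (gtn_eqF t_gt0) (gtn_eqF k1_gt0).
  rewrite modnMl mod0n eqxx mulr1 add0r expn0 !expr1 => E'.
  apply: (mulIf M_neq0).
  by rewrite E' -[LHS]mulrA [LHS]mulrC.
have: zeta ^+ (Q ^ k1) == zeta.
  have := etrans (Et 1%N isT isT) (esym (Et 2%N isT isT)).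
  (* the power Q^(k - k1) removes one shift by k1, as F^k fixes zeta *)
  rewrite mul1n => /(congr1 (fun x => x ^+ (Q ^ (k - k1)))).
  have le_k1 : (k1 <= k)%N by rewrite Dk leq_pmull.
  rewrite -!exprM -!expnD subnKC // mul2n -addnn -addnA subnKC // addnC expnD.
  by have := zeta_fix_expQk 1; rewrite !mul1n expr1 exprM => -> <-.
have := @zeta_expQ_eq 1 alpha.-1; rewrite mul1n expr1 => -> //.
by rewrite logn1 add0n leqNgt prednK ?leqnn.
Qed.

End BasicSubgroup.

Theorem proposition4p6
    (p e q : nat) (Fq : finFieldType) (Fbar : closedFieldType)
    (iota : {rmorphism Fq -> Fbar}) (eta : int) (l m alpha gamma : nat)
    (zeta : Fbar) (g1 : 'M[Fbar]_(l ^ alpha))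
    (p_prime : prime p) (q_def : q = (p ^ e)%N) (Fq_card : #|Fq| = q)
    (Fbar_alg : forall x : Fbar, algebraicOver iota x)
    (eta_def : eta = 1 \/ eta = -1)
    (l_prime : prime l) (l_odd : odd l) (l_neq_p : l <> p)
    (l_dvd : (l%:Z %| q%:Z - eta)%Z)
    (m_gt0 : (1 <= m)%N) :
  let a := logn l (absz (q%:Z - eta)) in
  let N := (m * l ^ (alpha + gamma))%N in
  let Gt := [set: GL_eta iota eta N] in
  let G := SL_eta iota eta N in
  let Rt := basic_subgroup iota eta m alpha gamma l_prime zeta g1 in
  (l ^ (a + alpha)).-primitive_root zeta ->
  \det g1 = 1 ->
  invmx g1 *m Frob Fq eta g1 = cycle_mx Fbar (l ^ alpha) ->
  radical_subgroup l Gt Rt ->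
  special_subgroup l Gt G Rt <-> ((a <= gamma + logn l m)%N \/ alpha = 0%N).
Proof.
move=> a N Gt G Rt; rewrite {}/Rt {}/G {}/Gt {}/N {}/a.
case: q / Fq_card q_def l_dvd => _ l_dvd zeta_prim det_g1 g1_twist radR.
have g1_unit := det1_unitmx det_g1.
have q_eta_gt0 : (0 < `|#|Fq|%:Z - eta|)%N.
  have q_gt1 := finNzRing_gt1 Fq.
  rewrite absz_gt0 subr_eq0; case: eta_def => ->.
    by rewrite -[1]/(1%N%:Z) eqz_nat gtn_eqF.
  by [].
have a_gt0 : (0 < logn l `|#|Fq|%:Z - eta|)%N.
  by rewrite -pfactor_dvdn // expn1.
have [Q [Q1_gt0 logQ twistQ]] :=
  exists_twisted_exponent Fbar alpha l_prime eta_def (erefl _) a_gt0.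
split=> [specR | [le_a | alpha0]].
- have [le_a|lt_a] := leqP (logn l `|#|Fq|%:Z - eta|) (gamma + logn l m).
    by left.
  right; apply/eqP; rewrite -leqn0 leqNgt; apply/negP=> alpha_gt0.
  by move: specR; apply/negP; apply: not_special alpha_gt0 lt_a; eassumption.
- apply: special_of_subset radR _.
  by apply: basic_subgroup_sub_SL le_a; eassumption.
by apply: special_alpha0 alpha0 radR; eassumption.
Qed.
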